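(* Let $n\ge 1$ and let $\ell\colon \mathbb{F}_2^{n-1}\to\mathbb{F}_2$ be a linear function with constant term equal to $0$, i.e. $\ell(x_{n-1},\dots,x_1)=\sum_{i=1}^{n-1}\ell_i x_i$ for some $\ell_1,\dots,\ell_{n-1}\in\mathbb{F}_2$. Then, as polynomials in $y$, $$G(\ell;y)=\sum_k N(\ell;k)\,y^k = 2^{-n}\prod_{\mathbf{c}\in C(\ell)} p_{d(\mathbf{c})}(y),$$ where $p_k(y)=(1+y)^k-(1-y)^k$ for $k>0$ and $p_0(y)=1$.
   Context: A (binary) De Bruijn sequence of order $n$ is a bi-infinite $0/1$ sequence $(\dots,x_{-1},x_0,x_1,\dots)$ with period $2^n$ such that every pattern of length $n$ appears exactly once in a period. A function $g\colon\mathbb{F}_2^{n-1}\to\mathbb{F}_2$ generates a De Bruijn sequence of order $n$ if there is a De Bruijn sequence of order $n$ satisfying $x_{i+n}=x_i+g(x_{i+n-1},\dots,x_{i+1})$ (addition in $\mathbb{F}_2$) for all $i\in\mathbb{Z}$. Let $S(n)$ be the set of functions $\mathbb{F}_2^{n-1}\to\mathbb{F}_2$ that generate a De Bruijn sequence of order $n$. The weight of a function $\mathbb{F}_2^{n-1}\to\mathbb{F}_2$ is the number of inputs at which it equals $1$. For $f\colon\mathbb{F}_2^{n-1}\to\mathbb{F}_2$, let $S(f;k)$ be the set of $g\in S(n)$ such that $g+f$ has weight $k$ (i.e. $f$ and $g$ disagree at exactly $k$ inputs), let $N(f;k)=|S(f;k)|$, and let $G(f;y)=\sum_k N(f;k)y^k$.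 For $f\colon\mathbb{F}_2^{n-1}\to\mathbb{F}_2$, let $C(f)$ be the set of bi-infinite binary sequences, up to cyclic shift, satisfying $x_{i+n}=x_i+f(x_{i+n-1},\dots,x_{i+1})$ for all $i\in\mathbb{Z}$. A necklace of length $r$ is an equivalence class of binary strings of length $r$ under cyclic rotation; it is primitive if it is not periodic with any period $p<r$ (cyclically, i.e. no nontrivial rotation fixes its strings). Each $\mathbf{c}\in C(f)$ is periodic and is represented by a unique primitive necklace, whose length is the least period of $\mathbf{c}$; $d(\mathbf{c})$ denotes the number of ones in that primitive necklace (the number of ones in one least period of $\mathbf{c}$). *)

(* Defs.v *)
From HB Require Import structures.
From mathcomp Require Import all_boot all_order all_algebra.
From mathcomp Require Import mathcomp_extra boolp classical_sets fsbigop.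

Set Implicit Arguments.
Unset Strict Implicit.
Unset Printing Implicit Defensive.

Import GRing.Theory.
Local Open Scope ring_scope.

Notation biseq := (int -> 'F_2).

Notation boolfun n := {ffun 'rV['F_2]_n.-1 -> 'F_2}.

(* The arguments are listed in decreasing order of index: coordinate k of
   [window n x i] is x_(i+n-1-k). *)
Definition window (n : nat) (x : biseq) (i : int) : 'rV['F_2]_n.-1 :=
  \row_(k < n.-1) x (i + (n.-1 - k)%N%:Z).

Definition satisfies (n : nat) (f : boolfun n) (x : biseq) : Prop :=
  forall i : int, x (i + n%:Z) = x i + f (window n x i).

(* A pattern may straddle the end of the period: only its starting position
   is taken in {0, ..., 2^n - 1}. *)
Definition de_bruijn (n : nat) (x : biseq) : Prop :=
  (forall i : int, x (i + (2 ^ n)%N%:Z) = x i) /\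
  (forall w : n.-tuple 'F_2, exists! i : 'I_(2 ^ n),
     forall j : 'I_n, x (i%:Z + j%:Z) = tnth w j).

Definition generates (n : nat) (g : boolfun n) : Prop :=
  exists x : biseq, de_bruijn n x /\ satisfies g x.

Definition DB (n : nat) : {set boolfun n} :=
  [set g : boolfun n | `[< generates g >]]%SET.

Definition weight (n : nat) (f : boolfun n) : nat :=
  #|[set v | f v == 1]%SET|.

Definition DB_at (n : nat) (f : boolfun n) (k : nat) : {set boolfun n} :=
  [set g in DB n | weight (g + f) == k]%SET.

Definition N (n : nat) (f : boolfun n) (k : nat) : nat := #|DB_at f k|.

(* A weight is at most 2^(n-1), so N f k = 0 for all the omitted k. *)
Definition G (n : nat) (f : boolfun n) : {poly rat} :=
  \sum_(k < (2 ^ n.-1).+1) (N f k)%:R *: 'X^k.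

Definition shift_class (x : biseq) : set biseq :=
  [set y | exists k : int, forall i : int, y i = x (i + k)]%classic.

(* C f is finite, since x is determined by n consecutive terms; hence the
   fsbigop product over C f is the genuine product over all of C f. *)
Definition C (n : nat) (f : boolfun n) : set (set biseq) :=
  [set shift_class x | x in [set x | satisfies f x]]%classic.

Definition primitive (w : seq 'F_2) : Prop :=
  (0 < size w)%N /\ forall r : nat, (0 < r < size w)%N -> rot r w <> w.

Definition periodic_ext (w : seq 'F_2) : biseq :=
  fun i => w`_(absz (i %% (size w)%:Z)%Z).

(* The primitive necklace of c is given by one of its strings, chosen
   arbitrarily; the number of ones is invariant under rotation. The default
   [::] is irrelevant for periodic c. *)
Definition necklace_string (c : set biseq) : seq 'F_2 :=
  xget [::] [set w | primitive w /\ c (periodic_ext w)]%classic.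

Definition d (c : set biseq) : nat := count_mem 1 (necklace_string c).

Definition pk (k : nat) : {poly rat} :=
  if k == 0%N then 1 else (1 + 'X) ^+ k - (1 - 'X) ^+ k.

(* Main.v *)
(** For a feedback function g, the state map x -> (x_1, ..., x_(n-1), x_0 + g)
is a permutation P_g of the N = 2^n states, and g generates a De Bruijn sequence
iff P_g is a single cycle.  Now det (z - P_g) = prod (z^|A| - 1) over the cycles
A; it is divisible by z - 1, and its derivative at z = 1 is N if P_g is a single
cycle and 0 otherwise.

Write g = ell + h.  Adding h swaps the images of the two states x, x' that
differ only in x_0, whenever h = 1 at their common tail.  Replacing the rows of
z - P_g indexed by x and x' by their sum and their difference therefore confines
the dependence on h to the sign of the P-part of the difference row, so
[sum_h y^|h| det (z - P_(ell+h))] is, by multilinearity, a single determinant, in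
which the difference rows carry 1 + y on z and 1 - y on P_ell.  For linear ell
the characters of F_2^n turn that matrix into z D - D' R, where R is the
permutation matrix of the map dual to P_ell and D, D' are diagonal with entries
1 + y, 1 - y at the states a with a_0 = 1, and 1 elsewhere.  Its determinant is
the product over the cycles of the dual map of z^|A| (1+y)^d(A) - (1-y)^d(A),
d(A) being the number of states of A with a_0 = 1.  The dual map is the Galois
form of the same shift register: a -> (k -> a^(k)_0) identifies its cycles with
the elements of C(ell).  The fixed point 0 contributes the factor z - 1; take the
derivative at z = 1. *)
From HB Require Import structures.
From mathcomp Require Import all_boot all_order all_algebra all_fingroup.
From mathcomp Require Import ring.

Set Implicit Arguments.
Unset Strict Implicit.
Unset Printing Implicit Defensive.

Import GRing.Theory.
Local Open Scope ring_scope.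

(** * Determinants and permutation cycles *)

(** Permutations of this form index the terms of the Leibniz expansion that can survive in
    [det_porbits]. *)
Definition switch_fun (T : finType) (s : {perm T}) (J : {set {set T}}) (x : T) : T :=
  if porbit s x \in J then s x else x.

Lemma porbit_permS (T : finType) (s : {perm T}) x : porbit s (s x) = porbit s x.
Proof. by have := porbit_perm s 1 x; rewrite expg1. Qed.

Lemma switch_fun_inj (T : finType) (s : {perm T}) J : injective (switch_fun s J).
Proof.
move=> x y; rewrite /switch_fun.
case: ifP => hx; case: ifP => hy //; first exact: perm_inj.
- by move=> exy; rewrite -exy porbit_permS hx in hy.
- by move=> exy; rewrite exy porbit_permS hy in hx.
Qed.

Definition switch (T : finType) (s : {perm T}) J : {perm T} := perm (@switch_fun_inj T s J).

Lemma porbit_switch (T : finType) (s : {perm T}) J x :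
  porbit (switch s J) x = if porbit s x \in J then porbit s x else [set x].
Proof.
have step k : (switch s J ^+ k)%g x =
    if porbit s x \in J then (s ^+ k)%g x else x.
  elim: k => [|k IH]; first by rewrite !expg0 !perm1 if_same.
  rewrite !expgSr !permM IH permE /switch_fun.
  by case: (boolP (porbit s x \in J)) => hx; rewrite ?porbit_perm ?hx ?(negbTE hx).
apply/setP => y; apply/porbitP/idP => [[k ->]|].
  by rewrite step; case: ifP => _; rewrite ?mem_porbit ?inE.
case: ifP => hx; last by rewrite inE => /eqP ->; exists 0%N; rewrite expg0 perm1.
by case/porbitP => k ->; exists k; rewrite step hx.
Qed.

Lemma porbits_trivIset (T : finType) (s : {perm T}) (J : {set {set T}}) :
  J \subset porbits s -> trivIset J.
Proof.
move=> /subsetP sJ; apply/trivIsetP => A B /sJ/imsetP[x _ ->] /sJ/imsetP[y _ ->] nxy.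
apply/pred0P => z /=; apply: contraNF nxy => /andP[zx zy].
by rewrite -!eq_porbit_mem in zx zy; rewrite -(eqP zx) -(eqP zy).
Qed.

Lemma mem_cover_porbits (T : finType) (s : {perm T}) (J : {set {set T}}) x :
  J \subset porbits s -> (x \in cover J) = (porbit s x \in J).
Proof.
move=> /subsetP sJ; apply/bigcupP/idP => [[A AJ xA]|xJ]; last first.
  by exists (porbit s x) => //; apply: porbit_id.
have /imsetP[y _ eA] := sJ _ AJ.
by move: xA AJ; rewrite eA -eq_porbit_mem => /eqP ->.
Qed.

(** The cycles of [switch s J] are the members of [J] and the singletons outside [cover J]; the
    parity of a permutation is that of #|T| minus its number of cycles. *)
Lemma odd_switch (T : finType) (s : {perm T}) (J : {set {set T}}) :
  J \subset porbits s -> odd_perm (switch s J) = odd #|cover J| (+) odd #|J|.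
Proof.
move=> sJ; rewrite /odd_perm.
have -> : porbits (switch s J) = (J :|: [set [set x] | x in ~: cover J]).
  apply/setP => A; rewrite inE; apply/imsetP/orP => [[x _ ->]|[AJ|/imsetP[x]]].
  - rewrite porbit_switch; case: ifP => hx; [by left|right].
    by apply: imset_f; rewrite inE (mem_cover_porbits _ sJ) hx.
  - have /imsetP[x _ eA] := subsetP sJ _ AJ.
    by exists x => //; rewrite porbit_switch -eA AJ.
  - rewrite inE (mem_cover_porbits _ sJ) => /negbTE xJ ->.
    by exists x => //; rewrite porbit_switch xJ.
rewrite cardsU card_imset; last exact: set1_inj.
rewrite disjoint_setI0 ?cards0 ?subn0; last first.
  apply/pred0P => A /=; apply: contraTF isT => /andP[AJ /imsetP[x]].
  by rewrite inE => /bigcupP xJ eA; case: xJ; exists A => //; rewrite eA inE.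
by rewrite oddD -(cardsC (cover J)) oddD addbCA -!addbA addbb addbF addbC.
Qed.

(** [K] is stable under [s]: if [s x] left [K], then [t] would fix [s x] and also send [x] to it,
    forcing [s x = x]. *)
Lemma cover_porbits_sub (T : finType) (s t : {perm T}) (K : {set T}) :
  (forall x, t x = if x \in K then s x else x) ->
  cover [set A in porbits s | A \subset K] = K.
Proof.
move=> tE; have sK x : x \in K -> s x \in K.
  move=> xK; apply: contraT => sxK.
  have : t (s x) = t x by rewrite !tE xK (negbTE sxK).
  by move/perm_inj => sxx; rewrite sxx xK in sxK.
have sKn k x : x \in K -> (s ^+ k)%g x \in K.
  by elim: k => [|k IH] xK; rewrite ?expg0 ?perm1 // expgSr permM sK ?IH.
apply/setP => x; apply/bigcupP/idP => [[A]|xK].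
  by rewrite inE => /andP[_ /subsetP AK] /AK.
exists (porbit s x); last exact: porbit_id.
rewrite inE imset_f //=; apply/subsetP => y /porbitP[k ->]; exact: sKn.
Qed.

Lemma prod_mulrb (R : comNzRingType) (T : finType) (P : pred T) (F : T -> R) :
  \prod_x (F x *+ P x) = (\prod_x F x) *+ [forall x, P x].
Proof.
case: (boolP [forall x, P x]) => [/forallP hP|].
  by rewrite mulr1n; apply: eq_bigr => x _; rewrite hP.
rewrite negb_forall => /existsP[x nPx].
by rewrite (bigD1 x) //= (negbTE nPx) mulr0n mul0r.
Qed.

Lemma prod_subsets (R : comNzRingType) (T : finType) (P : {set T}) (F G : T -> R) :
  \prod_(x in P) (F x + G x) =
  \sum_(J : {set T} | J \subset P) (\prod_(x in J) F x * \prod_(x in P :\: J) G x).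
Proof.
rewrite big_mkcond /=.
under eq_bigr => x _.
  (* Extending [F] by 0 and [G] by 1 outside [P] kills the choice sets not contained in [P]. *)
  rewrite (_ : (if _ then _ else _) =
    (if x \in P then F x else 0) + (if x \in P then G x else 1)); last first.
    by case: ifP; rewrite ?add0r.
  over.
rewrite bigA_distr [LHS](bigID (fun J : {set T} => J \subset P)) /= [X in _ + X]big1 ?addr0.
  apply: eq_big => // J JP.
  rewrite (bigID [in J]) /=; congr (_ * _).
    by apply: eq_bigr => x xJ; rewrite xJ (subsetP JP).
  rewrite [RHS]big_mkcond [LHS]big_mkcond; apply: eq_bigr => x _.
  by rewrite inE; case: (x \in J).
move=> J /subsetPn[x xJ nxP].
by rewrite (bigD1 x) //= xJ (negbTE nxP) mul0r.
Qed.

(* A term of the Leibniz expansion survives only for permutations mapping each i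
   to i or s i, i.e. those that agree with s on a union of cycles of s and are
   the identity elsewhere. *)
Lemma det_porbits (R : comNzRingType) (n : nat) (s : {perm 'I_n}) (a b : 'I_n -> R) :
  \det (\matrix_(i, j) (a i *+ (i == j) - b i *+ (s i == j))) =
  \prod_(A in porbits s) (\prod_(i in A) a i - \prod_(i in A) b i).
Proof.
pose orb (K : {set 'I_n}) := [set A in porbits s | A \subset K].
have orbS K : orb K \subset porbits s by apply/subsetP => A; rewrite inE => /andP[].
pose w (K : {set 'I_n}) := \prod_i (if i \in K then - b i else a i).
pose moves (K : {set 'I_n}) (t : {perm 'I_n}) :=
  [forall i, (if i \in K then s i else i) == t i].
have movesE K t : moves K t -> cover (orb K) = K.
  by move/forallP => tE; apply: (@cover_porbits_sub _ s t) => x; rewrite (eqP (tE x)).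
(* [K] is the set of rows from which the [- b] entry is taken. *)
transitivity (\sum_K \sum_(t : {perm 'I_n}) (-1) ^+ t * (w K *+ moves K t)).
  rewrite exchange_big; apply: eq_bigr => t _ /=.
  rewrite -big_distrr /=; congr (_ * _).
  under eq_bigr => i _ do rewrite mxE addrC.
  rewrite bigA_distr; apply: eq_bigr => K _.
  rewrite -prod_mulrb; apply: eq_bigr => i _.
  by case: ifP => _ //; rewrite mulNrn.
under [RHS]eq_bigr => A _ do rewrite addrC.
rewrite prod_subsets (bigID (fun K => K == cover (orb K))) /=.
rewrite [X in _ + X]big1 ?addr0; last first.
  move=> K nK; rewrite big1 // => t _.
  have -> : moves K t = false by apply: contraNF nK => /movesE {1}<-.
  by rewrite mulr0n mulr0.
rewrite (reindex_onto (@cover _) orb) /=; last by move=> K /eqP <-.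
apply: eq_big => J; last first.
  case/andP=> /eqP eK /eqP eJ; have JP : J \subset porbits s by rewrite -eJ.
  rewrite (bigD1 (switch s J)) //= [X in _ + X]big1 ?addr0; last first.
    move=> t nt; suff -> : moves (cover J) t = false by rewrite mulr0n mulr0.
    apply: contraNF nt => /forallP tE; apply/eqP/permP => i.
    by rewrite -(eqP (tE i)) permE /switch_fun (mem_cover_porbits _ JP).
  have -> : moves (cover J) (switch s J).
    by apply/forallP => i; rewrite permE /switch_fun (mem_cover_porbits _ JP).
  rewrite mulr1n odd_switch // /w (bigID [in cover J]) /=.
  rewrite (eq_bigr (fun i => -1 * b i)); last by move=> i ->; rewrite mulN1r.
  rewrite [X in _ * (_ * X)](eq_bigr a); last by move=> i /negbTE ->.
  (* The sign (-1)^#|cover J| occurs twice, in the parity and in the entries [- b i], and cancels;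
     one sign per cycle of [J] remains. *)
  rewrite big_split /= prodr_const signr_addb !signr_odd.
  rewrite !mulrA [_ * (-1) ^+ #|J|]mulrC -(mulrA _ (_ ^+ _) (_ ^+ _)) -expr2 sqrr_sign mulr1.
  rewrite (big_trivIset _ (porbits_trivIset JP)) /=; congr (_ * _).
    by under [RHS]eq_bigr => A _ do rewrite -mulN1r; rewrite big_split /= prodr_const.
  have DP : porbits s :\: J \subset porbits s by exact: subsetDl.
  rewrite -(big_trivIset _ (porbits_trivIset DP)) /=.
  apply: eq_bigl => x; rewrite (mem_cover_porbits _ JP) (mem_cover_porbits _ DP).
  by rewrite inE imset_f // andbT.
apply/andP/idP => [[_ /eqP <-] //|JP].
have eJ : orb (cover J) = J.
  apply/setP => A; rewrite inE; apply/andP/idP => [[/imsetP[x _ ->] /subsetP xJ]|AJ].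
    by rewrite -(mem_cover_porbits _ JP) xJ ?porbit_id.
  by split; [apply: (subsetP JP)|apply: (bigcup_sup A)].
by rewrite eJ !eqxx.
Qed.

(** Rows and columns are transported to ordinals by [enum_val], so that [\det] applies to matrices
    indexed by states. *)
Definition fmx (R : Type) (T : finType) (A : T -> T -> R) : 'M[R]_#|T| :=
  \matrix_(i, j) A (enum_val i) (enum_val j).

Lemma fmxM (R : comNzRingType) (T : finType) (A B : T -> T -> R) :
  fmx A *m fmx B = fmx (fun x y => \sum_z A x z * B z y).
Proof.
apply/matrixP => i j; rewrite !mxE (big_enum_val (A := T)).
by apply: eq_bigr => k _; rewrite !mxE.
Qed.

Lemma eq_fmx (R : Type) (T : finType) (A B : T -> T -> R) :
  (forall x y, A x y = B x y) -> fmx A = fmx B.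
Proof. by move=> eAB; apply/matrixP => i j; rewrite !mxE. Qed.

Lemma fmx_diag (R : comNzRingType) (T : finType) (c : R) :
  fmx (fun x y : T => c *+ (x == y)) = c%:M.
Proof. by apply/matrixP => i j; rewrite !mxE (inj_eq enum_val_inj). Qed.

Lemma big_deltal (R : comNzRingType) (T : finType) (x : T) (F : T -> R) :
  \sum_z (x == z)%:R * F z = F x.
Proof.
rewrite (bigD1 x) //= eqxx mul1r big1 ?addr0 // => z.
by rewrite eq_sym => /negbTE ->; rewrite mul0r.
Qed.

Definition enum_conj_fun (T : finType) (s : {perm T}) (i : 'I_#|T|) : 'I_#|T| :=
  enum_rank (s (enum_val i)).

Lemma enum_conj_inj (T : finType) (s : {perm T}) : injective (enum_conj_fun s).
Proof. by move=> i j /enum_rank_inj/perm_inj/enum_val_inj. Qed.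

Lemma det_fmx_porbits (R : comNzRingType) (T : finType) (s : {perm T}) (a b : T -> R) :
  \det (fmx (fun x y => a x *+ (x == y) - b x *+ (s x == y))) =
  \prod_(A in porbits s) (\prod_(x in A) a x - \prod_(x in A) b x).
Proof.
pose s' := perm (@enum_conj_inj T s).
have s'E k i : enum_val ((s' ^+ k)%g i) = (s ^+ k)%g (enum_val i).
  elim: k => [|k IH]; first by rewrite !expg0 !perm1.
  by rewrite !expgSr !permM permE /enum_conj_fun enum_rankK IH.
have orbE i : [set enum_val j | j in porbit s' i] = porbit s (enum_val i).
  apply/setP => x; apply/imsetP/porbitP => [[j /porbitP[k ->] ->]|[k ->]].
    by exists k; rewrite s'E.
  by exists ((s' ^+ k)%g i); rewrite ?s'E // mem_porbit.
have -> : porbits s = [set [set enum_val j | j in A : {set 'I_#|T|}] | A in porbits s'].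
  apply/setP => A; apply/imsetP/imsetP => [[x _ ->]|[B /imsetP[i _ ->] ->]].
    exists (porbit s' (enum_rank x)); first exact: imset_f.
    by rewrite orbE enum_rankK.
  by exists (enum_val i).
rewrite big_imset /=; last by move=> A B _ _; apply/imset_inj/enum_val_inj.
transitivity (\prod_(A in porbits s')
    (\prod_(i in A) a (enum_val i) - \prod_(i in A) b (enum_val i))); last first.
  by apply: eq_bigr => A _; rewrite !big_imset //=; move=> i j _ _; apply: enum_val_inj.
rewrite -det_porbits; congr (\det _); apply/matrixP => i j; rewrite !mxE.
by rewrite (inj_eq enum_val_inj) permE (can2_eq (@enum_rankK T) (@enum_valK T)).
Qed.

(** Multilinearity in the selected rows, which [r] and [p] identify with [W]: the function [h]
    chooses one summand for each of these rows independently. *)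
Lemma det_fmx_expand (R : comNzRingType) (T W J : finType) (sel : pred T)
    (p : T -> W) (r : W -> T) (c : J -> R) (F : J -> T -> T -> R) (A : T -> T -> R) :
  (forall w, sel (r w)) -> cancel r p -> {in sel, cancel p r} ->
  \sum_(h : {ffun W -> J}) (\prod_w c (h w)) *
     \det (fmx (fun x y => if sel x then F (h (p x)) x y else A x y)) =
  \det (fmx (fun x y => if sel x then \sum_j c j * F j x y else A x y)).
Proof.
move=> selr rK pK.
have prodE (G : T -> T -> R) (t : 'S_#|T|) :
    \prod_i fmx (fun x y => if sel x then G x y else A x y) i (t i) =
    (\prod_w G (r w) (enum_val (t (enum_rank (r w))))) *
    \prod_(x | ~~ sel x) A x (enum_val (t (enum_rank x))).
  rewrite (reindex (@enum_rank T)) /=; last by apply: onW_bij; apply: enum_rank_bij.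
  rewrite (bigID sel) /=; congr (_ * _); last first.
    by apply: eq_bigr => x /negbTE nx; rewrite mxE enum_rankK nx.
  rewrite (reindex_onto r p) //=.
  by apply: eq_big => [w|w _]; rewrite ?selr ?rK ?eqxx // mxE enum_rankK selr.
rewrite /determinant.
under [LHS]eq_bigr => h _ do rewrite big_distrr /=.
rewrite exchange_big; apply: eq_bigr => t _ /=.
rewrite prodE bigA_distr_bigA mulr_suml mulr_sumr.
apply: eq_bigr => h _; rewrite prodE mulrCA; congr (_ * _).
rewrite mulrA -big_split /=; congr (_ * _).
by apply: eq_bigr => w _; rewrite rK.
Qed.

(** * Shift registers and their duals *)

(* A state is (x_0, ..., x_m) in increasing order of index, whereas the arguments
   of a feedback function come in decreasing order, whence the rev_ord. *)
Definition tail_rev (m : nat) (x : 'rV['F_2]_m.+1) : 'rV['F_2]_m :=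
  \row_k x 0 (lift ord0 (rev_ord k)).

Definition next_state (m : nat) (g : 'rV['F_2]_m -> 'F_2) (x : 'rV['F_2]_m.+1) :
    'rV['F_2]_m.+1 :=
  \row_j if unlift ord_max j is Some i then x 0 (lift ord0 i)
         else x 0 0 + g (tail_rev x).

Definition flip0 (m : nat) (x : 'rV['F_2]_m.+1) : 'rV['F_2]_m.+1 :=
  \row_j (x 0 j + (j == 0)%:R).

(* Adjoint of next_state for the pairing dotp, when the feedback function is the
   linear form with coefficients l. *)
Definition dual_next (m : nat) (l : 'rV['F_2]_m) (a : 'rV['F_2]_m.+1) :
    'rV['F_2]_m.+1 :=
  \row_j if unlift ord0 j is Some i
         then a 0 (lift ord_max i) + a 0 ord_max * l 0 (rev_ord i)
         else a 0 ord_max.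

Definition dotp (n : nat) (x a : 'rV['F_2]_n) : 'F_2 := \sum_j x 0 j * a 0 j.

Lemma F2_case (u : 'F_2) : u = 0 \/ u = 1.
Proof. by case: u => [[|[|u]] // hu]; [left|right]; apply/val_inj. Qed.

Lemma addF2 (u : 'F_2) : u + u = 0.
Proof. by case: (F2_case u) => ->; apply/val_inj. Qed.

Lemma flip0K m : involutive (@flip0 m).
Proof. by move=> x; apply/rowP => j; rewrite !mxE -addrA addF2 addr0. Qed.

Lemma flip00 m (x : 'rV_m.+1) : flip0 x 0 0 = x 0 0 + 1.
Proof. by rewrite mxE. Qed.

Lemma tail_rev_flip0 m (x : 'rV_m.+1) : tail_rev (flip0 x) = tail_rev x.
Proof. by apply/rowP => k; rewrite !mxE addr0. Qed.

Lemma next_state_lift m (g : 'rV_m -> 'F_2) x i :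
  next_state g x 0 (lift ord_max i) = x 0 (lift ord0 i).
Proof. by rewrite mxE liftK. Qed.

Lemma next_state_max m (g : 'rV_m -> 'F_2) x :
  next_state g x 0 ord_max = x 0 0 + g (tail_rev x).
Proof. by rewrite mxE unlift_none. Qed.

Lemma dual_next_lift m l (a : 'rV_m.+1) i :
  dual_next l a 0 (lift ord0 i) = a 0 (lift ord_max i) + a 0 ord_max * l 0 (rev_ord i).
Proof. by rewrite mxE liftK. Qed.

Lemma dual_next0 m l (a : 'rV_m.+1) : dual_next l a 0 0 = a 0 ord_max.
Proof. by rewrite mxE unlift_none. Qed.

Lemma tail_rev_eq m (x y : 'rV_m.+1) :
  (forall i, x 0 (lift ord0 i) = y 0 (lift ord0 i)) -> tail_rev x = tail_rev y.
Proof. by move=> e; apply/rowP => k; rewrite !mxE. Qed.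

Lemma next_state_inj m (g : 'rV_m -> 'F_2) : injective (next_state g).
Proof.
move=> x y exy; have e i : x 0 (lift ord0 i) = y 0 (lift ord0 i).
  by rewrite -!(next_state_lift g) exy.
have := next_state_max g x; rewrite exy next_state_max (tail_rev_eq e) => /addIr e0.
by apply/rowP => j; case: (unliftP 0 j) => [i ->|-> //].
Qed.

Lemma dual_next_inj m l : injective (@dual_next m l).
Proof.
move=> a b eab; have e : a 0 ord_max = b 0 ord_max by rewrite -!(dual_next0 l) eab.
apply/rowP => j; case: (unliftP ord_max j) => [i ->|-> //].
by have := dual_next_lift l a i; rewrite eab dual_next_lift e => /addIr.
Qed.

Definition state_perm m (g : 'rV_m -> 'F_2) := perm (@next_state_inj m g).
Definition dual_perm m l := perm (@dual_next_inj m l).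

(** On the left, x_(i+1) is multiplied by a_i through the shift and by a_m times a coefficient of
    [l] through the feedback; x_0 is multiplied by a_m. *)
Lemma dotp_dual m (g : 'rV_m -> 'F_2) (l : 'rV_m) x a :
  (forall v, g v = \sum_k l 0 k * v 0 k) ->
  dotp (next_state g x) a = dotp x (dual_next l a).
Proof.
move=> gE; rewrite /dotp (bigD1_ord ord_max) //= [RHS](bigD1_ord 0) //=.
rewrite next_state_max dual_next0 mulrDl -!addrA; congr (_ + _).
rewrite gE mulr_suml [X in X + _](reindex_inj rev_ord_inj) /= -big_split /=.
apply: eq_bigr => i _; rewrite next_state_lift dual_next_lift mxE rev_ordK.
by rewrite addrC mulrDr; congr (_ + _); rewrite mulrAC mulrC [a 0 _ * _]mulrC.
Qed.

(** The tail does not see x_0, which enters the new state only additively; hence adding 1 to the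
    feedback amounts to flipping x_0. *)
Lemma next_state_switch m (g : {ffun 'rV_m -> 'F_2}) h x :
  next_state (g + h) x = next_state g (if h (tail_rev x) == 1 then flip0 x else x).
Proof.
have hE v : (g + h) v = g v + h v by rewrite ffunE.
case: (F2_case (h (tail_rev x))) => hx; rewrite hx ?eqxx /=.
  by apply/rowP => j; rewrite !mxE; case: unliftP => // _; rewrite hE hx addr0.
apply/rowP => j; rewrite !mxE; case: unliftP => [i _|_].
  by rewrite mxE addr0.
by rewrite hE hx tail_rev_flip0 eqxx addrA addrAC.
Qed.

(** * Characters of F_2^n *)

Definition sgn (R : pzRingType) (u : 'F_2) : R := (-1) ^+ u.

Lemma sgnD (R : comNzRingType) u v : sgn R (u + v) = sgn R u * sgn R v.
Proof.
by case: (F2_case u) => ->; case: (F2_case v) => ->;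
  rewrite /sgn /= ?expr0 ?expr1 ?mulr1 ?mul1r ?mulrNN ?mulr1.
Qed.

Definition charac (R : pzRingType) n (x a : 'rV['F_2]_n) : R := sgn R (dotp x a).

Lemma dotpDl n (x y a : 'rV['F_2]_n) : dotp (x + y) a = dotp x a + dotp y a.
Proof. by rewrite /dotp -big_split; apply: eq_bigr => j _; rewrite mxE mulrDl. Qed.

Lemma dotpDr n (x a b : 'rV['F_2]_n) : dotp x (a + b) = dotp x a + dotp x b.
Proof. by rewrite /dotp -big_split; apply: eq_bigr => j _; rewrite mxE mulrDr. Qed.

Lemma dotp_delta n (x : 'rV['F_2]_n) j : dotp x (delta_mx 0 j) = x 0 j.
Proof.
rewrite /dotp (bigD1 j) //= mxE !eqxx mulr1 big1 ?addr0 // => i /negbTE ij.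
by rewrite mxE ij mulr0.
Qed.

(** If x_j = 1, translating [a] by the j-th unit vector negates every term, so the sum equals its
    opposite. *)
Lemma sum_charac (R : idomainType) n (x : 'rV['F_2]_n) : 2%:R != 0 :> R ->
  x != 0 -> \sum_a charac R x a = 0.
Proof.
move=> R2 x0; have /existsP[j /eqP xj] : [exists j, x 0 j == 1].
  apply: contraNT x0 => /existsPn nx; apply/eqP/rowP => j.
  by rewrite mxE; case: (F2_case (x 0 j)) (nx j) => // ->; rewrite eqxx.
have : \sum_a charac R x a = - \sum_a charac R x a.
  rewrite {1}(reindex_inj (addIr (delta_mx 0 j))) -sumrN /=; apply: eq_bigr => a _.
  by rewrite /charac dotpDr dotp_delta xj sgnD {2}/sgn expr1 mulrN1.
by move/eqP; rewrite -subr_eq0 opprK -mulr2n -mulr_natr mulf_eq0 (negbTE R2) orbF => /eqP.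
Qed.

(** * The generating determinant *)

(* The row of a state x with x_0 = 0 is the sum, that of a state with x_0 = 1 the
   difference, of the unit rows of flip0 x and x. *)
Definition hadamard (R : comNzRingType) m (x y : 'rV['F_2]_m.+1) : R :=
  (flip0 x == y)%:R + sgn R (x 0 0) * (x == y)%:R.

Lemma sum_hadamard (R : comNzRingType) m (F : 'rV['F_2]_m.+1 -> R) x :
  \sum_u hadamard R x u * F u = F (flip0 x) + sgn R (x 0 0) * F x.
Proof.
under eq_bigr => u _ do rewrite /hadamard mulrDl -mulrA.
by rewrite big_split /= -big_distrr /= !big_deltal.
Qed.

Lemma sgn1 (R : pzRingType) : sgn R 1 = -1.
Proof. exact: expr1. Qed.

Lemma sgn_sqr (R : comNzRingType) u : sgn R u * sgn R u = 1.
Proof. by rewrite -sgnD addF2. Qed.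

Lemma det_hadamard (R : idomainType) m : 2%:R != 0 :> R ->
  \det (fmx (@hadamard R m)) != 0.
Proof.
move=> R2; suff : \det (fmx (@hadamard R m) *m fmx (@hadamard R m)) != 0.
  by rewrite det_mulmx mulf_eq0 orbb.
(* The matrix squares to twice the identity. *)
rewrite fmxM (_ : fmx _ = (2%:R)%:M) ?det_scalar ?expf_neq0 //.
rewrite -fmx_diag; apply: eq_fmx => x y; rewrite sum_hadamard /hadamard.
rewrite flip0K flip00 sgnD sgn1 mulrDr mulrA sgn_sqr mul1r mulrN1 mulNr.
by rewrite addrA subrK -mulr2n mulrnAC.
Qed.

Lemma det_charac (R : idomainType) n : 2%:R != 0 :> R ->
  \det (fmx (@charac R n)) != 0.
Proof.
move=> R2; pose tr (x y : 'rV_n) := charac R y x.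
suff : \det (fmx (@charac R n) *m fmx tr) != 0.
  by rewrite det_mulmx mulf_eq0 => /norP[].
(* Orthogonality of characters: the product with the transpose is the scalar 2^n. *)
rewrite fmxM (_ : fmx _ = (#|'rV['F_2]_n|%:R)%:M).
  rewrite det_scalar expf_neq0 // card_mx mul1n card_Fp // natrX expf_neq0 //.
rewrite -fmx_diag; apply: eq_fmx => x y.
under eq_bigr => z _ do rewrite /tr /charac -sgnD -dotpDl.
case: eqVneq => [<-|nxy]; last first.
  rewrite mulr0n sum_charac //; apply: contraNneq nxy => exy.
  by rewrite -[x]addr0 -[0](_ : y + y = 0) ?addrA ?exy ?add0r //;
    apply/rowP => j; rewrite !mxE addF2.
rewrite mulr1n (eq_bigr (fun=> 1)) ?sumr_const // => z _.
rewrite (_ : x + x = 0); last by apply/rowP => j; rewrite !mxE addF2.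
by rewrite /dotp big1 // => j _; rewrite mxE mul0r.
Qed.

Lemma charac_flip0 (R : comNzRingType) m (x a : 'rV['F_2]_m.+1) :
  charac R (flip0 x) a = sgn R (a 0 0) * charac R x a.
Proof.
have -> : flip0 x = delta_mx 0 0 + x.
  by apply/rowP => j; rewrite !mxE eqxx addrC.
rewrite /charac dotpDl sgnD; congr (sgn R _ * _).
rewrite /dotp (bigD1 0) //= mxE !eqxx mul1r big1 ?addr0 // => i /negbTE ij.
by rewrite mxE ij mul0r.
Qed.

Lemma charac_next (R : comNzRingType) m (g : 'rV_m -> 'F_2) (l : 'rV_m) x a :
  (forall v, g v = \sum_k l 0 k * v 0 k) ->
  charac R (next_state g x) a = charac R x (dual_next l a).
Proof. by move=> gE; rewrite /charac (dotp_dual _ _ gE). Qed.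

Lemma big_F2 (R : nmodType) (G : 'F_2 -> R) : \sum_e G e = G 0 + G 1.
Proof.
rewrite (bigD1 0) //= (bigD1 1) //= big1 ?addr0 // => e.
by case: (F2_case e) => ->.
Qed.

(** The diagonal matrices D and D' are given by [row_wt y] and [row_wt (- y)]. *)
Definition row_wt (R : pzRingType) (y : R) m (x : 'rV['F_2]_m.+1) : R :=
  if x 0 0 == 1 then 1 + y else 1.

(** Entries of the product of [hadamard] with the permutation matrix of [next_state g]. *)
Definition hadamard_next (R : comNzRingType) m g (x y : 'rV['F_2]_m.+1) : R :=
  (next_state g (flip0 x) == y)%:R + sgn R (x 0 0) * (next_state g x == y)%:R.

(** A section of [tail_rev] whose image is the set of states with x_0 = 1; it indexes the difference
    rows by tails. *)
Definition ins1 m (w : 'rV['F_2]_m) : 'rV['F_2]_m.+1 :=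
  \row_j if unlift ord0 j is Some i then w 0 (rev_ord i) else 1.

Lemma ins10 m (w : 'rV_m) : ins1 w 0 0 = 1.
Proof. by rewrite mxE unlift_none. Qed.

Lemma ins1K m : cancel (@ins1 m) (@tail_rev m).
Proof. by move=> w; apply/rowP => k; rewrite !mxE liftK rev_ordK. Qed.

Lemma tail_revK m (x : 'rV_m.+1) : x 0 0 == 1 -> ins1 (tail_rev x) = x.
Proof.
move=> /eqP x0; apply/rowP => j; rewrite mxE; case: unliftP => [i ->|->].
  by rewrite mxE rev_ordK.
by rewrite x0.
Qed.

(** Where [h] is 1 the images of [x] and [flip0 x] are swapped: the sum row is unchanged and the
    difference row changes sign. *)
Lemma hadamard_nextD (R : comNzRingType) m (g h : {ffun 'rV_m -> 'F_2}) x y :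
  hadamard_next R (g + h) x y =
  (if x 0 0 == 1 then sgn R (h (tail_rev x)) else 1) * hadamard_next R g x y.
Proof.
rewrite /hadamard_next !next_state_switch tail_rev_flip0.
case: (F2_case (h (tail_rev x))) => ->; rewrite ?eqxx /=.
  by rewrite [sgn R 0]expr0 if_same mul1r.
rewrite flip0K sgn1; case: (F2_case (x 0 0)) => ->; rewrite ?eqxx /=.
  by rewrite [sgn R 0]expr0 !mul1r addrC.
by rewrite sgn1 !mulN1r opprD opprK addrC.
Qed.

Lemma sum_cycles_next (R : idomainType) m (g : {ffun 'rV['F_2]_m -> 'F_2}) (y z : R) :
  2%:R != 0 :> R ->
  \det (fmx (@hadamard R m)) * (\sum_(h : {ffun 'rV['F_2]_m -> 'F_2})
    (\prod_w (if h w == 1 then y else 1)) *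
    \prod_(A in porbits (state_perm (g + h))) (z ^+ #|A| - 1)) =
  \det (fmx (fun x u => row_wt y x * z * hadamard R x u
                        - row_wt (- y) x * hadamard_next R g x u)).
Proof.
move=> R2; pose sel := [pred x : 'rV['F_2]_m.+1 | x 0 0 == 1].
(* [F e] is a difference row when [h] takes the value e at its tail; a sum row is always [F 0].
   Summing with weights, [F 0 + y * F 1] carries 1 + y on the z part and 1 - y on the other. *)
pose F (e : 'F_2) (x u : 'rV['F_2]_m.+1) : R :=
  z * hadamard R x u - sgn R e * hadamard_next R g x u.
have tK : {in sel, cancel (@tail_rev m) (@ins1 m)} by move=> x; apply: tail_revK.
have := det_fmx_expand (fun e : 'F_2 => if e == 1 then y else 1) F (F 0) 
  (fun w => introT eqP (ins10 w) : sel (ins1 w)) (@ins1K m) tK.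
set L := LHS; set D := RHS => LD; transitivity L; last first.
  rewrite LD /D; congr (\det _); apply: eq_fmx => x u /=.
  rewrite /row_wt; case: ifP => _; last first.
    by rewrite /F [sgn R 0]expr0 !mul1r.
  by rewrite big_F2 eqxx /= /F [sgn R 0]expr0 sgn1; ring.
rewrite /L big_distrr; apply: eq_bigr => h _ /=.
rewrite mulrCA; congr (_ * _).
transitivity (\det (fmx (@hadamard R m)) * \det (fmx (fun v u : 'rV_m.+1 =>
    z *+ (v == u) - 1 *+ (state_perm (g + h) v == u)))).
  congr (_ * _); rewrite det_fmx_porbits; apply: eq_bigr => A _.
  by rewrite !prodr_const expr1n.
rewrite -det_mulmx fmxM; congr (\det _); apply: eq_fmx => x u.
rewrite sum_hadamard /= !permE.
transitivity (z * hadamard R x u - hadamard_next R (g + h) x u).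
  rewrite /hadamard /hadamard_next -![z *+ _]mulr_natr.
  move: (flip0 x == u) (x == u) (_ == u) (_ == u) (sgn R _) => b1 b2 b3 b4 s.
  by move: (b1%:R) (b2%:R) (b3%:R) (b4%:R) => c1 c2 c3 c4; ring.
by rewrite hadamard_nextD /F; case: ifP; rewrite ?[sgn R 0]expr0.
Qed.

(* The bracket is (sgn a_0 + sgn x_0) charac x a, which vanishes unless x_0 = a_0. *)
Lemma row_wt_charac (R : comNzRingType) (y : R) m (x a : 'rV['F_2]_m.+1) :
  row_wt y x * (charac R (flip0 x) a + sgn R (x 0 0) * charac R x a) =
  row_wt y a * (charac R (flip0 x) a + sgn R (x 0 0) * charac R x a).
Proof.
rewrite charac_flip0 -mulrDl /row_wt.
case: (F2_case (x 0 0)) => ->; case: (F2_case (a 0 0)) => -> //;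
  by rewrite [sgn R 0]expr0 sgn1 ?addNr ?addrN mul0r !mulr0.
Qed.

Lemma det_fourier (R : idomainType) m (g : 'rV['F_2]_m -> 'F_2) (l : 'rV['F_2]_m) (y z : R) :
  2%:R != 0 :> R -> (forall v, g v = \sum_k l 0 k * v 0 k) ->
  \det (fmx (fun x u => row_wt y x * z * hadamard R x u
                        - row_wt (- y) x * hadamard_next R g x u)) =
  \det (fmx (@hadamard R m)) * \prod_(A in porbits (dual_perm l))
    (z ^+ #|A| * \prod_(a in A) row_wt y a - \prod_(a in A) row_wt (- y) a).
Proof.
move=> R2 gE; apply: (mulIf (det_charac m.+1 R2)).
set s := dual_perm l.
(* Column a of [K] is supported at b = a and at b = [dual_next l a], hence the inverse of [s] in row
   form; [s] and its inverse have the same cycles. *)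
pose K (b a : 'rV['F_2]_m.+1) : R :=
  (row_wt y b * z) *+ (b == a) - row_wt (- y) b *+ ((s^-1)%g b == a).
have -> : \prod_(A in porbits s)
    (z ^+ #|A| * \prod_(a in A) row_wt y a - \prod_(a in A) row_wt (- y) a) =
    \det (fmx K).
  rewrite det_fmx_porbits porbitsV; apply: eq_bigr => A _.
  by rewrite big_split prodr_const mulrC.
rewrite -mulrA [X in _ = _ * X]mulrC mulrA -!det_mulmx !fmxM; congr (\det _).
apply: eq_fmx => x a.
have sVE b : ((s^-1)%g b == a) = (b == dual_next l a).
  by rewrite (can2_eq (permKV s) (permK s)) permE.
(* [W b] is the entry at (x, b) of the product of the [hadamard] and character matrices. *)
pose W b := charac R (flip0 x) b + sgn R (x 0 0) * charac R x b.
have W_next u : W (dual_next l u) =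
    \sum_v hadamard_next R g x v * charac R v u.
  rewrite /W -!(charac_next R _ _ gE) /hadamard_next.
  under [RHS]eq_bigr => v _ do rewrite mulrDl -mulrA.
  by rewrite big_split /= -big_distrr /= !big_deltal.
transitivity (row_wt y x * z * W a - row_wt (- y) x * W (dual_next l a)).
  rewrite W_next /W -(sum_hadamard (fun v => charac R v a)) !big_distrr -sumrB.
  apply: eq_bigr => u _.
  by rewrite mulrBl /= !mulrA.
under [RHS]eq_bigr => b _ do rewrite sum_hadamard -/(W b) mulrBr.
rewrite sumrB (bigD1 a) //= eqxx mulr1n [X in _ + X - _]big1 ?addr0; last first.
  by move=> b /negbTE ->; rewrite mulr0n mulr0.
rewrite (bigD1 (dual_next l a)) //= [X in _ - (_ + X)]big1 ?addr0; last first.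
  by move=> b /negbTE nb; rewrite sVE nb mulr0n mulr0.
rewrite sVE eqxx mulr1n.
(* [row_wt_charac] moves each weight from the row index x to the argument of [W], as [K]
   requires. *)
congr (_ - _); last by rewrite row_wt_charac mulrC.
by rewrite mulrAC row_wt_charac -/(W a) mulrAC mulrC.
Qed.

Definition num1 m (A : {set 'rV['F_2]_m.+1}) : nat := #|[set a in A | a 0 0 == 1]|.

Lemma prod_row_wt (R : comNzRingType) (y : R) m (A : {set 'rV['F_2]_m.+1}) :
  \prod_(a in A) row_wt y a = (1 + y) ^+ num1 A.
Proof.
by rewrite -big_mkcondr /= -prodr_const; apply: eq_bigl => a; rewrite inE.
Qed.

Lemma sum_prod_porbits (R : idomainType) m (g : {ffun 'rV['F_2]_m -> 'F_2})
    (l : 'rV['F_2]_m) (y z : R) :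
  2%:R != 0 :> R -> (forall v, g v = \sum_k l 0 k * v 0 k) ->
  \sum_(h : {ffun 'rV['F_2]_m -> 'F_2}) y ^+ #|[set w | h w == 1]| *
    \prod_(A in porbits (state_perm (g + h))) (z ^+ #|A| - 1) =
  \prod_(A in porbits (dual_perm l))
    (z ^+ #|A| * (1 + y) ^+ num1 A - (1 - y) ^+ num1 A).
Proof.
move=> R2 gE; apply: (mulfI (det_hadamard m R2)).
under [in RHS]eq_bigr => A _ do rewrite -!prod_row_wt.
rewrite -(det_fourier y z R2 gE) -sum_cycles_next //; congr (_ * _).
apply: eq_bigr => h _; congr (_ * _).
by rewrite -big_mkcond /= -prodr_const; apply: eq_bigl => w; rewrite inE.
Qed.

(** * Sequences of the dual register *)

(** Reducing the exponent modulo the order of [s] covers negative exponents, so an orbit becomes a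
    bi-infinite sequence. *)
Definition int_pow (T : finType) (s : {perm T}) (i : int) : {perm T} :=
  (s ^+ absz (i %% #[s]%g)%Z)%g.

Lemma int_powD (T : finType) (s : {perm T}) i j x :
  int_pow s (i + j) x = int_pow s j (int_pow s i x).
Proof.
have o0 : (#[s]%g : int) != 0 by rewrite eqz_nat -lt0n order_gt0.
rewrite -permM /int_pow -expgD -[in RHS]expg_mod_order; congr ((s ^+ _)%g x).
apply/eqP; rewrite -eqz_nat -modz_nat PoszD !gez0_abs ?modz_ge0 //.
by rewrite modzDml modzDmr.
Qed.

Lemma int_pow_nat (T : finType) (s : {perm T}) (k : nat) : int_pow s k = (s ^+ k)%g.
Proof. by rewrite /int_pow modz_nat absz_nat expg_mod_order. Qed.

Lemma int_pow0 (T : finType) (s : {perm T}) x : int_pow s 0 x = x.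
Proof. by rewrite int_pow_nat expg0 perm1. Qed.

Lemma int_pow1 (T : finType) (s : {perm T}) i x : int_pow s (i + 1) x = s (int_pow s i x).
Proof. by rewrite int_powD (int_pow_nat s 1) expg1. Qed.

Lemma mem_int_pow (T : finType) (s : {perm T}) i x : int_pow s i x \in porbit s x.
Proof. exact: mem_porbit. Qed.

(* The only state of the dual register that, at time i, belongs to an orbit with
   0-th coordinates b: unfolding dual_next, coordinate j at time i depends only on
   the 0-th coordinates at times i - j, ..., i. *)
Definition dual_state m (l : 'rV['F_2]_m) (b : int -> 'F_2) (i : int) : 'rV['F_2]_m.+1 :=
  \row_j (b (i - j%:Z) +
          \sum_(t < m | (t < j)%N) b (i - j%:Z + t.+1%:Z) * l 0 (rev_ord t)).

(** The relation [satisfies] for the linear form with coefficients [l], with the terms in increasing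
    order of index, whence the [rev_ord]. *)
Definition recurrent m (l : 'rV['F_2]_m) (b : int -> 'F_2) :=
  forall i, b (i + m.+1%:Z) = b i + \sum_(t < m) b (i + t.+1%:Z) * l 0 (rev_ord t).

Lemma dual_state0 m l b i : @dual_state m l b i 0 0 = b i.
Proof. by rewrite mxE subr0 big_pred0 ?addr0. Qed.

Lemma dual_state_lift m (l : 'rV_m) b i (j : 'I_m) :
  dual_state l b (i + 1) 0 (lift ord0 j) =
  dual_state l b i 0 (lift ord_max j) + b (i + 1) * l 0 (rev_ord j).
Proof.
have eij : i + 1 - (lift ord0 j)%:Z = i - j%:Z.
  by rewrite lift0 -addn1 PoszD opprD addrACA subrr addr0.
rewrite !mxE eij (_ : (lift ord_max j)%:Z = j) ?lift_max // -addrA; congr (_ + _).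
rewrite (bigD1 j) ?lift0 //= addrC; congr (_ + _); last first.
  by congr (b _ * _); rewrite -addn1 PoszD addrA subrK.
by apply: eq_bigl => t; rewrite ltnS ltn_neqAle andbC -val_eqE.
Qed.

(** The recurrence enters only through the last coordinate, which it identifies with b (i + 1). *)
Lemma dual_state_next m (l : 'rV_m) b : recurrent l b ->
  forall i, dual_next l (dual_state l b i) = dual_state l b (i + 1).
Proof.
move=> bP i; have emax : dual_state l b i 0 ord_max = b (i + 1).
  rewrite mxE (_ : i + 1 = i - m%:Z + m.+1%:Z); last by rewrite -addn1 PoszD addrA subrK.
  rewrite bP; congr (_ + _); apply: eq_bigl => t; exact: ltn_ord.
apply/rowP => j; case: (unliftP 0 j) => [k ->|->].
  by rewrite dual_next_lift emax dual_state_lift.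
by rewrite dual_next0 emax dual_state0.
Qed.

Lemma dual_stateE m (l : 'rV_m) (a : int -> 'rV_m.+1) :
  (forall i, a (i + 1) = dual_next l (a i)) ->
  forall i, a i = dual_state l (fun k => a k 0 0) i.
Proof.
move=> aS; have amax i : a i 0 ord_max = a (i + 1) 0 0 by rewrite aS dual_next0.
suff e (k : nat) i (j : 'I_m.+1) :
    j = k :> nat -> a i 0 j = dual_state l (fun k => a k 0 0) i 0 j.
  by move=> i; apply/rowP => j; apply: e.
elim: k => [|k IH] in i j *.
  by move=> j0; rewrite (_ : j = 0) ?dual_state0 //; apply/val_inj.
case: (unliftP 0 j) => [t -> /eqP|-> //].
(* Coordinate t + 1 at time i is obtained from coordinate t at time i - 1. *)
rewrite lift0 eqSS => /eqP tk; rewrite -[i](subrK 1) dual_state_lift aS dual_next_lift.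
by rewrite amax aS IH ?lift_max.
Qed.

Lemma recurrent_dual m (l : 'rV_m) (a : int -> 'rV_m.+1) :
  (forall i, a (i + 1) = dual_next l (a i)) -> recurrent l (fun k => a k 0 0).
Proof.
move=> aS i.
have -> : i + m.+1%:Z = i + m%:Z + 1 by rewrite -addn1 PoszD addrA.
rewrite {1}aS dual_next0 (dual_stateE aS) mxE addrK; congr (_ + _).
by apply: eq_bigl => t; exact: ltn_ord.
Qed.

Definition dual_orbit m (l : 'rV['F_2]_m) (a : 'rV['F_2]_m.+1) (i : int) :=
  int_pow (dual_perm l) i a.

Lemma dual_orbitS m (l : 'rV_m) a i :
  dual_orbit l a (i + 1) = dual_next l (dual_orbit l a i).
Proof. by rewrite /dual_orbit int_pow1 permE. Qed.

Definition dual_seq m (l : 'rV['F_2]_m) a (i : int) : 'F_2 := dual_orbit l a i 0 0.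

Lemma dual_seq_inj m (l : 'rV_m) a a' i : dual_seq l a =1 dual_seq l a' ->
  dual_orbit l a i = dual_orbit l a' i.
Proof.
move=> e; rewrite [LHS](dual_stateE (dual_orbitS l a)).
rewrite [RHS](dual_stateE (dual_orbitS l a')); apply/rowP => j; rewrite !mxE.
by congr (_ + _); [exact: e|apply: eq_bigr => t _; congr (_ * _); exact: e].
Qed.

Lemma dual_seq_recurrent m (l : 'rV_m) a : recurrent l (dual_seq l a).
Proof. exact/recurrent_dual/dual_orbitS. Qed.

Lemma recurrentP m (l : 'rV_m) b : recurrent l b ->
  b =1 dual_seq l (dual_state l b 0).
Proof.
move=> bP i; rewrite -(dual_state0 l) /dual_seq; congr (_ 0 0).
have S := dual_state_next bP.
suff e (k : nat) j : dual_state l b (j + k%:Z) = int_pow (dual_perm l) k (dual_state l b j).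
  case: i => k; first by rewrite -[in LHS](add0r (Posz k)) e.
  (* For a negative time, the state at 0 is k + 1 forward steps later, and the negative power undoes
     these steps. *)
  have {1}-> : 0 = Negz k + k.+1%:Z by rewrite NegzE addNr.
  by rewrite e /dual_orbit -int_powD NegzE subrr int_pow0.
elim: k j => [|k IH] j; first by rewrite addr0 int_pow0.
have -> : Posz k.+1 = k%:Z + 1 by rewrite -addn1 PoszD.
by rewrite addrA -S IH int_pow1 permE.
Qed.

Lemma porbit_dvdn (T : finType) (s : {perm T}) x k :
  (s ^+ k)%g x = x -> (#|porbit s x| %| k)%N.
Proof.
move=> sk; have p0 : (0 < #|porbit s x|)%N by rewrite lt0n card_porbit_neq0.
have sp q : (s ^+ (q * #|porbit s x|))%g x = x.
  elim: q => [|q IH]; first by rewrite expg0 perm1.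
  by rewrite mulSn addnC expgD permM IH permX iter_porbit.
have : nth x (traject s x #|porbit s x|) (k %% #|porbit s x|) =
       nth x (traject s x #|porbit s x|) 0.
  rewrite !nth_traject ?ltn_pmod //= -permX.
  by rewrite -[RHS]sk [in RHS](divn_eq k #|porbit s x|) expgD permM sp.
move/eqP; rewrite nth_uniq ?size_traject ?ltn_pmod ?uniq_traject_porbit //.
Qed.

Lemma int_periodic (T : Type) (F : int -> T) (p : nat) :
  (forall i, F (i + p%:Z) = F i) -> forall i, F (i %% p%:Z)%Z = F i.
Proof.
move=> FP i; rewrite [in RHS](divz_eq i p%:Z) addrC.
move: (i %/ _)%Z (i %% _)%Z => q r; elim/int_rect: q => [|k IH|k IH].
- by rewrite mul0r addr0.
- by rewrite IH -[LHS]FP -addn1 PoszD mulrDl mul1r addrA.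
- by rewrite IH -[RHS]FP -addn1 PoszD opprD mulrDl mulN1r addrA subrK.
Qed.

Lemma dual_seqD m (l : 'rV_m) a k i :
  dual_seq l (int_pow (dual_perm l) k a) i = dual_seq l a (i + k).
Proof. by rewrite /dual_seq /dual_orbit -int_powD addrC. Qed.

Lemma dual_seq_eq m (l : 'rV_m) a b : dual_seq l a =1 dual_seq l b -> a = b.
Proof. by move=> /dual_seq_inj-/(_ 0); rewrite /dual_orbit !int_pow0. Qed.

(** The sequence determines the state, so its periods are the multiples of the cycle length. *)
Lemma dual_seq_period m (l : 'rV_m) a (k : nat) :
  (forall i, dual_seq l a (i + k%:Z) = dual_seq l a i) <->
  (#|porbit (dual_perm l) a| %| k)%N.
Proof.
split=> [e|/dvdnP[q ->] i].
  apply: porbit_dvdn; rewrite -int_pow_nat; apply: (@dual_seq_eq _ l) => i.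
  by rewrite dual_seqD.
rewrite -dual_seqD int_pow_nat; congr (dual_seq l _ i).
elim: q => [|q IH]; first by rewrite expg0 perm1.
by rewrite mulSn addnC expgD permM IH permX iter_porbit.
Qed.

Lemma num1_porbit m (l : 'rV_m) a :
  count_mem 1 (mkseq (fun i : nat => dual_seq l a i) #|porbit (dual_perm l) a|) =
  num1 (porbit (dual_perm l) a).
Proof.
set s := dual_perm l; set p := #|_|.
have -> : mkseq (fun i : nat => dual_seq l a i) p =
    [seq u 0 0 | u : 'rV_m.+1 <- traject s a p].
  apply: (@eq_from_nth _ 0); rewrite size_mkseq ?size_map ?size_traject // => i ip.
  rewrite nth_mkseq // (nth_map a) ?size_traject // nth_traject //.
  by rewrite /dual_seq /dual_orbit int_pow_nat permX.
rewrite count_map -size_filter /num1.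
have /card_uniqP <- :
    uniq [seq u <- traject s a p | preim (fun u : 'rV_m.+1 => u 0 0) (pred1 1) u].
  by rewrite filter_uniq // uniq_traject_porbit.
by apply: eq_card => u; rewrite mem_filter in_set porbit_traject andbC.
Qed.

Lemma porbit_dual0 m (l : 'rV_m) : porbit (dual_perm l) 0 = [set 0].
Proof.
have d0 : dual_perm l 0 = 0.
  rewrite permE; apply/rowP => j; rewrite !mxE.
  by case: unliftP => [i _|_]; rewrite ?mxE ?mul0r ?addr0.
apply/setP => a; rewrite inE; apply/porbitP/eqP => [[k ->]|->]; last first.
  by exists 0%N; rewrite expg0 perm1.
by elim: k => [|k IH]; rewrite ?expg0 ?perm1 // expgSr permM IH.
Qed.

Lemma num1_set0 m : num1 [set 0 : 'rV['F_2]_m.+1] = 0%N.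
Proof.
by apply: eq_card0 => a; rewrite !inE; apply/negP => /andP[/eqP ->]; rewrite mxE.
Qed.

(** A cycle whose states all have a_0 = 0 yields the zero sequence, which comes only from the state
    0. Thus the case p_0 = 1 occurs for the zero cycle alone. *)
Lemma num1_eq0 m (l : 'rV_m) A : A \in porbits (dual_perm l) ->
  (num1 A == 0%N) = (A == [set 0]).
Proof.
have z (u : 'rV['F_2]_m.+1) B : num1 B = 0%N -> u \in B -> u 0 0 = 0.
  move=> /card0_eq/(_ u); rewrite !inE => /negbT; rewrite negb_and => /orP[/negP //|].
  by case: (F2_case (u 0 0)) => // ->; rewrite eqxx.
case/imsetP => a _ ->; apply/eqP/eqP => [n0|->]; last by rewrite num1_set0.
rewrite -(porbit_dual0 l); congr (porbit _ _); apply: (@dual_seq_eq _ l) => i.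
rewrite /dual_seq /dual_orbit (z _ _ n0) ?mem_int_pow //.
by rewrite (z _ _ (num1_set0 m)) // -(porbit_dual0 l) mem_int_pow.
Qed.

(** * Detecting a single cycle by a derivative at 1 *)

Lemma porbits_set1 (T : finType) (s : {perm T}) x :
  (#|porbits s| == 1%N) = (porbit s x == setT).
Proof.
apply/cards1P/eqP => [[A eA]|eT].
  apply/setP => y; rewrite inE -eq_porbit_mem.
  have : porbit s x \in porbits s by apply: imset_f.
  have : porbit s y \in porbits s by apply: imset_f.
  by rewrite eA !inE => /eqP -> /eqP ->; rewrite eqxx.
exists setT; apply/setP => A; rewrite inE; apply/imsetP/eqP => [[y _ ->]|->].
  by rewrite -eT; apply/eqP; rewrite eq_porbit_mem eT inE.
by exists x.
Qed.

(** Every factor vanishes at 1, so two distinct cycles make 1 a multiple root. *)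
Lemma deriv_prod_porbits (R : comNzRingType) (T : finType) (s : {perm T}) (x : T) :
  (\prod_(A in porbits s) ('X^#|A| - 1 : {poly R}))^`().[1] =
  #|T|%:R *+ (#|porbits s| == 1%N).
Proof.
have xA : porbit s x \in porbits s by exact: imset_f.
have h1 k : ('X^k - 1 : {poly R}).[1] = 0 by rewrite !hornerE expr1n subrr.
rewrite (bigD1 (porbit s x)) //= derivM hornerD !hornerM h1 mul0r addr0.
rewrite derivB derivXn derivC subr0 hornerMn hornerXn expr1n.
rewrite (porbits_set1 s x); case: eqVneq => [eT|nT].
  rewrite eT cardsT big_pred0 ?hornerE ?mulr1 // => A.
  apply: contraNF (_ : ~~ false) => // /andP[/imsetP[y _ ->] /eqP []].
  by rewrite -eT; apply/eqP; rewrite eq_porbit_mem eT inE.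
have [y yx] : exists y, y \notin porbit s x.
  apply/existsP; rewrite -negb_forall; apply: contra nT => /forallP xT.
  by apply/eqP/setP => y; rewrite xT inE.
rewrite (bigD1 (porbit s y)) /=; last by rewrite imset_f //= eq_porbit_mem.
by rewrite hornerM h1 mul0r mulr0.
Qed.

Lemma sum_single_cycle (R : idomainType) m (g : {ffun 'rV['F_2]_m -> 'F_2})
    (l : 'rV['F_2]_m) (y : R) :
  2%:R != 0 :> R -> (forall v, g v = \sum_k l 0 k * v 0 k) ->
  (2 ^ m.+1)%:R * (\sum_(h : {ffun 'rV['F_2]_m -> 'F_2} |
    #|porbits (state_perm (g + h))| == 1%N) y ^+ #|[set w | h w == 1]|) =
  \prod_(A in porbits (dual_perm l) | A != [set 0])
    ((1 + y) ^+ num1 A - (1 - y) ^+ num1 A).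
Proof.
move=> R2 gE.
have R2' : 2%:R != 0 :> {poly R} by rewrite -polyC_natr polyC_eq0.
(* The identity is applied over {poly R} with z the indeterminate and y a constant. *)
have := sum_prod_porbits (g := g) (l := l) y%:P 'X R2' gE.
move=> /(congr1 (fun p : {poly R} => p^`().[1])).
rewrite raddf_sum horner_sum => e; transitivity (\sum_(h : {ffun 'rV['F_2]_m -> 'F_2})
    (y%:P ^+ #|[set w | h w == 1]| *
      \prod_(A in porbits (state_perm (g + h))) ('X^#|A| - 1))^`().[1]).
  rewrite big_distrr big_mkcond /=; apply: eq_bigr => h _.
  rewrite -rmorphXn /= mul_polyC derivZ hornerZ.
  rewrite (deriv_prod_porbits R _ 0) card_mx card_Fp // mul1n.
  by case: ifP => _; rewrite ?mulr0n ?mulr0 // mulr1n mulrC.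
rewrite e.
have A0 : [set 0] \in porbits (dual_perm l) by rewrite -(porbit_dual0 l) imset_f.
(* The cycle of 0 contributes X - 1, so only the term differentiating this factor survives at 1. *)
rewrite (bigD1 [set 0]) //= num1_set0 cards1 !expr0 mulr1 expr1.
rewrite derivM hornerD !hornerM !hornerE subrr mul0r addr0.
rewrite derivB derivX derivC subr0 hornerC mul1r.
rewrite horner_prod; apply: eq_bigr => A _.
by rewrite !hornerE expr1n mul1r.
Qed.

(** * De Bruijn sequences and necklaces *)

(* These imports come late because classical_sets shadows the names of finset. *)
Require Import Defs.
From mathcomp Require Import mathcomp_extra boolp classical_sets fsbigop.

Definition state_at m (x : int -> 'F_2) (i : int) : 'rV['F_2]_m.+1 :=
  \row_j x (i + j%:Z).

Lemma addrzS (i : int) (k : nat) : i + k.+1%:Z = i + 1 + k%:Z.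
Proof. by rewrite -addn1 PoszD -addrA; congr (_ + _); rewrite addrC. Qed.

Lemma tail_rev_state_at m x i : tail_rev (state_at m x i) = window m.+1 x i.
Proof.
apply/rowP => k; rewrite !mxE; congr (x (i + Posz _)).
by rewrite lift0 /= subnSK.
Qed.

Lemma state_at0 m x i : state_at m x i 0 0 = x i.
Proof. by rewrite mxE addr0. Qed.

Lemma satisfies_next m (g : boolfun m.+1) x : satisfies g x ->
  forall i, state_perm g (state_at m x i) = state_at m x (i + 1).
Proof.
move=> gx i; rewrite permE; apply/rowP => j; case: (unliftP ord_max j) => [k ->|->].
  by rewrite next_state_lift !mxE lift0 lift_max addrzS.
by rewrite next_state_max state_at0 tail_rev_state_at mxE -gx addrzS.
Qed.

Lemma satisfies_pow m (g : boolfun m.+1) x : satisfies g x ->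
  forall (k : nat) i, (state_perm g ^+ k)%g (state_at m x i) = state_at m x (i + k%:Z).
Proof.
move=> gx; elim=> [|k IH] i; first by rewrite expg0 perm1 addr0.
by rewrite expgSr permM IH satisfies_next // addrzS addrAC.
Qed.

(** Since the register shifts, coordinate j at time i is coordinate 0 at time i + j. *)
Lemma state_at_pow m (g : boolfun m.+1) u i :
  state_at m (fun k => int_pow (state_perm g) k u 0 0) i = int_pow (state_perm g) i u.
Proof.
suff e (k : nat) i' (j : 'I_m.+1) : j = k :> nat ->
    int_pow (state_perm g) (i' + j%:Z) u 0 0 = int_pow (state_perm g) i' u 0 j.
  by apply/rowP => j; rewrite mxE; apply: e.
elim: k => [|k IH] in i' j *.
  by move=> j0; rewrite j0 addr0; congr (_ _ _); apply/val_inj.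
case: (unliftP 0 j) => [t -> /eqP|-> //].
rewrite lift0 eqSS => /eqP tk.
have -> : i' + t.+1%:Z = i' + 1 + (lift ord_max t)%:Z.
  by rewrite lift_max addrzS.
by rewrite IH ?lift_max // int_pow1 permE next_state_lift.
Qed.

Lemma satisfies_orbit m (g : boolfun m.+1) u :
  satisfies g (fun k => int_pow (state_perm g) k u 0 0).
Proof.
move=> i; rewrite -tail_rev_state_at state_at_pow -next_state_max.
rewrite -(permE (@next_state_inj m g)) -int_pow1.
by rewrite -(state_at_pow g u (i + 1)) mxE addrzS.
Qed.

(** The patterns of length n read along the sequence are the successive states of the register, so
    each occurs once per period exactly when one cycle runs through all states. *)
Lemma generatesP m (g : boolfun m.+1) :
  generates g <-> #|porbits (state_perm g)| = 1%N.
Proof.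
have card_st : #|'rV['F_2]_m.+1| = (2 ^ m.+1)%N by rewrite card_mx card_Fp // mul1n.
split=> [[x [[_ xP] gx]]|/eqP].
  apply/eqP; rewrite (porbits_set1 _ (state_at m x 0)); apply/eqP/setP => u; rewrite inE.
  have [i [iP _]] := xP [tuple u 0 j | j < m.+1].
  apply/porbitP; exists i; rewrite satisfies_pow // add0r.
  by apply/rowP => j; rewrite mxE iP tnth_mktuple.
rewrite (porbits_set1 _ 0) => /eqP sT; set s := state_perm g in sT.
exists (fun k => int_pow s k 0 0 0); split; last exact: satisfies_orbit.
have cs : #|porbit s 0| = (2 ^ m.+1)%N by rewrite sT cardsT.
have stE (i : 'I_(2 ^ m.+1)) (w : m.+1.-tuple 'F_2) :
    (forall j : 'I_m.+1, int_pow s (i%:Z + j%:Z) 0 0 0 = tnth w j) <->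
    nth 0 (traject s 0 #|porbit s 0|) i = \row_j tnth w j.
  rewrite nth_traject ?cs // -permX -int_pow_nat -state_at_pow.
  split=> [h|h j]; first by apply/rowP => j; rewrite !mxE h.
  by have /rowP/(_ j) := h; rewrite !mxE.
split=> [i|w].
  by rewrite addrC int_powD int_pow_nat -cs permX iter_porbit.
have : \row_j tnth w j \in traject s 0 #|porbit s 0| by rewrite -porbit_traject sT inE.
move=> wt; have iw : (index (\row_j tnth w j) (traject s 0%R #|porbit s 0%R|) < 2 ^ m.+1)%N.
  by rewrite -cs -[X in (_ < X)%N](size_traject s 0) index_mem.
(* The position of a pattern is its index in the traversal of the cycle starting at 0. *)
exists (Ordinal iw); split=> [|i' /stE e]; first by apply/stE; rewrite nth_index.
apply/val_inj => /=; rewrite -e index_uniq ?uniq_traject_porbit //.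
by rewrite size_traject cs.
Qed.

(** * Cycles of the dual register and elements of C *)

Lemma satisfies_recurrent m (g : boolfun m.+1) (l : 'rV['F_2]_m) x :
  (forall v, g v = \sum_k l 0 k * v 0 k) -> satisfies g x <-> recurrent l x.
Proof.
move=> gE; have e i : g (window m.+1 x i) = \sum_(t < m) x (i + t.+1%:Z) * l 0 (rev_ord t).
  rewrite gE (reindex_inj rev_ord_inj); apply: eq_bigr => t _ /=.
  by rewrite mxE mulrC; congr (x (i + Posz _) * _); rewrite /= subKn.
by split=> h i; have := h i; rewrite e.
Qed.

(** The class is independent of the picked state by [porbit_classE]; the default 0 is never reached
    on an orbit. *)
Definition porbit_class m (l : 'rV['F_2]_m) (A : {set 'rV['F_2]_m.+1}) : set biseq :=
  shift_class (dual_seq l (odflt 0 [pick a in A])).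

Lemma shift_class_dual m (l : 'rV_m) a b :
  shift_class (dual_seq l a) (dual_seq l b) <-> b \in porbit (dual_perm l) a.
Proof.
split=> [[k bE]|/porbitP[k ->]].
  suff -> : b = int_pow (dual_perm l) k a by exact: mem_int_pow.
  by apply: (@dual_seq_eq _ l) => i; rewrite bE dual_seqD.
by exists k%:Z => i; rewrite -dual_seqD int_pow_nat.
Qed.

Lemma eq_shift_class m (l : 'rV_m) a b : b \in porbit (dual_perm l) a ->
  shift_class (dual_seq l a) = shift_class (dual_seq l b).
Proof.
move=> /shift_class_dual [k bE]; apply/seteqP; split=> y [j yE].
  by exists (j - k) => i; rewrite yE bE; congr (dual_seq l a _); rewrite -addrA subrK.
by exists (j + k) => i; rewrite yE bE addrA.
Qed.

Lemma porbit_classE m (l : 'rV_m) a :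
  porbit_class l (porbit (dual_perm l) a) = shift_class (dual_seq l a).
Proof.
rewrite /porbit_class; case: pickP => [b /eq_shift_class //|/(_ a)].
by rewrite porbit_id.
Qed.

Lemma porbit_class_inj m (l : 'rV_m) :
  {in porbits (dual_perm l) &, injective (porbit_class l)}.
Proof.
move=> A B /imsetP[a _ ->] /imsetP[b _ ->]; rewrite !porbit_classE => e.
apply/eqP; rewrite eq_porbit_mem; apply/shift_class_dual; rewrite -e.
by exists 0 => i; rewrite addr0.
Qed.

Lemma C_porbits m (g : boolfun m.+1) (l : 'rV['F_2]_m) :
  (forall v, g v = \sum_k l 0 k * v 0 k) ->
  C g = (porbit_class l @` [set` porbits (dual_perm l)])%classic.
Proof.
move=> gE; apply/seteqP; split=> c [].
  move=> x /(satisfies_recurrent x gE) xP <-.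
  exists (porbit (dual_perm l) (dual_state l x 0)) => /=; first exact: imset_f.
  rewrite porbit_classE; congr shift_class; apply/esym/funext; exact: recurrentP.
move=> A /imsetP[a _ ->] <-; exists (dual_seq l a); last by rewrite porbit_classE.
exact/(satisfies_recurrent _ gE)/dual_seq_recurrent.
Qed.

(** * Primitive necklaces *)

Lemma periodic_ext_nat w (i : nat) : (i < size w)%N -> periodic_ext w i = w`_i.
Proof. by move=> iw; rewrite /periodic_ext modz_nat absz_nat modn_small. Qed.

Lemma periodic_extD w i : periodic_ext w (i + (size w)%:Z) = periodic_ext w i.
Proof. by rewrite /periodic_ext modzDr. Qed.

Lemma nth_rot w (r i : nat) : (r <= size w)%N -> (i < size w)%N ->
  (rot r w)`_i = periodic_ext w (i%:Z + r%:Z).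
Proof.
move=> rw iw; rewrite /rot nth_cat size_drop nth_drop.
case: ltnP => h; first by rewrite -PoszD [(i + r)%N]addnC periodic_ext_nat // -ltn_subRL.
rewrite nth_take; last by rewrite ltn_subLR // subnK.
rewrite -periodic_ext_nat; last by rewrite (leq_ltn_trans _ iw) // leq_subr.
rewrite -periodic_extD; congr periodic_ext.
by rewrite -!PoszD; congr Posz; rewrite subnBA // subnK // addnC -leq_subLR.
Qed.

(** The length of [w] is a multiple of the cycle length p; were it larger, rotation by p would fix
    [w]. *)
Lemma primitive_dual_seq m (l : 'rV_m) a w :
  primitive w -> periodic_ext w =1 dual_seq l a ->
  w = mkseq (fun i : nat => dual_seq l a i) #|porbit (dual_perm l) a|.
Proof.
move=> [w0 wP] wE; set p := #|_|.
have pw : (p %| size w)%N.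
  by apply/dual_seq_period => i; rewrite -!wE periodic_extD.
have p0 : (0 < p)%N by rewrite lt0n card_porbit_neq0.
have sw : size w = p.
  apply/eqP; rewrite eqn_leq [X in _ && X]dvdn_leq // andbT leqNgt; apply/negP => lpw.
  apply: (wP p); first by rewrite p0.
  apply: (@eq_from_nth _ 0); rewrite size_rot // => i iw.
  rewrite nth_rot ?(ltnW lpw) // wE -periodic_ext_nat // wE.
  exact: (proj2 (dual_seq_period l a p) (dvdnn _)).
apply: (@eq_from_nth _ 0); rewrite ?size_mkseq // => i iw.
by rewrite nth_mkseq -?sw // -wE periodic_ext_nat.
Qed.

Lemma primitive_exists m (l : 'rV_m) a :
  let w := mkseq (fun i : nat => dual_seq l a i) #|porbit (dual_perm l) a| in
  primitive w /\ periodic_ext w =1 dual_seq l a.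
Proof.
set p := #|_| => w; have sw : size w = p by rewrite size_mkseq.
have p0 : (0 < p)%N by rewrite lt0n card_porbit_neq0.
have aP i : dual_seq l a (i %% p%:Z)%Z = dual_seq l a i.
  by apply: int_periodic; apply/dual_seq_period.
have modp (i : int) : exists2 k : nat, (k < p)%N & (i %% p%:Z)%Z = k.
  have pz : p%:Z != 0 by rewrite eqz_nat -lt0n.
  exists (absz (i %% p%:Z)%Z); last by rewrite gez0_abs ?modz_ge0.
  by rewrite -ltz_nat gez0_abs ?modz_ge0 // ltz_pmod // ltz_nat.
have wE : periodic_ext w =1 dual_seq l a.
  move=> i; rewrite /periodic_ext sw -aP; have [k kp ->] := modp i.
  by rewrite nth_mkseq.
split=> //; split=> [|r]; first by rewrite sw.
(* A rotation fixing [w] makes r a period, hence a multiple of p, which 0 < r < p excludes. *)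
rewrite sw => /andP[r0 rp] rw; suff : (p %| r)%N by rewrite gtnNdvd.
apply/dual_seq_period => i.
have aPr j : dual_seq l a (j + r%:Z) = dual_seq l a ((j %% p%:Z)%Z + r%:Z).
  by rewrite -[LHS]aP -[RHS]aP modzDml.
rewrite aPr -[RHS]aP; have [k kp ->] := modp i.
by rewrite -!wE -nth_rot ?sw ?(ltnW rp) // rw periodic_ext_nat ?sw.
Qed.

Lemma d_porbit_class m (l : 'rV_m) A :
  A \in porbits (dual_perm l) -> d (porbit_class l A) = num1 A.
Proof.
case/imsetP => a _ ->; rewrite porbit_classE /d /necklace_string.
set P := [set w | _]%classic.
have [w0P w0E] := primitive_exists l a.
have : P (xget [::] P).
  apply: (@xgetPex _ [::] P); eexists; split; first exact: w0P.
  by exists 0 => i; rewrite addr0 w0E.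
move: (xget _ _) => w [wP [k wE]].
(* The chosen string represents a shift of the sequence of [a], which is the sequence of another
   state of the same cycle. *)
have wE' : periodic_ext w =1 dual_seq l (int_pow (dual_perm l) k a).
  by move=> i; rewrite wE dual_seqD.
rewrite (primitive_dual_seq wP wE') num1_porbit; congr num1.
by apply/eqP; rewrite eq_porbit_mem mem_int_pow.
Qed.

Lemma weight_le m (f : boolfun m.+1) : (weight f < (2 ^ m).+1)%N.
Proof. by rewrite ltnS (leq_trans (max_card _)) // card_mx card_Fp // mul1n. Qed.

(** Grouping by weight removes the coefficients [N]; the substitution g = f + h turns g + f into h
    in characteristic 2. *)
Lemma G_sum m (f : boolfun m.+1) :
  G f = \sum_(h : boolfun m.+1 | #|porbits (state_perm (f + h))| == 1%N)
          'X^#|[set w | h w == 1]%SET|.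
Proof.
have ff : f + f = 0 by apply/ffunP => v; rewrite !ffunE addF2.
transitivity (\sum_(g in DB m.+1) ('X^(weight (g + f)) : {poly rat})).
  rewrite (partition_big (fun g => Ordinal (weight_le (g + f))) predT) //=.
  apply: eq_bigr => k _; rewrite scaler_nat /N -sumr_const.
  by apply: eq_big => [g|g]; rewrite inE -?val_eqE //= => /andP[_ /eqP ->].
rewrite (reindex_inj (addrI f)); apply: eq_big => h.
  by rewrite inE; apply/asboolP/eqP => /generatesP.
by rewrite addrAC ff add0r.
Qed.

Theorem theorem1p1 (n : nat) (hn : (1 <= n)%N)
    (ell : {ffun 'rV['F_2]_n.-1 -> 'F_2}) (l : 'rV['F_2]_n.-1)
    (hell : forall v : 'rV['F_2]_n.-1,
        ell v = \sum_(i < n.-1) l 0 i * v 0 i) :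
  G ell = (2 ^- n) *: \big[*%R/1]_(c \in C ell) pk (d c).
Proof.
case: n hn ell l hell => // m _ ell l hell.
rewrite G_sum (C_porbits hell) fsbig_image; last first.
  by move=> A B; rewrite !inE; exact: porbit_class_inj.
have -> : \big[*%R/1]_(A \in [set` porbits (dual_perm l)]%classic) pk (d (porbit_class l A)) =
    \prod_(A in porbits (dual_perm l)) pk (num1 A).
  rewrite -(@bigfs _ _ _ _ (index_enum _)) ?index_enum_uniq //; last first.
    by move=> A _; rewrite mem_index_enum.
  by apply: eq_bigr => A /d_porbit_class ->.
have A0 : [set 0]%SET \in porbits (dual_perm l) by rewrite -(porbit_dual0 l) imset_f.
(* The zero cycle contributes [pk 0], which is 1. *)
rewrite (bigD1 [set 0]%SET) //= num1_set0 mul1r.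
have R2 : 2%:R != 0 :> {poly rat} by rewrite -polyC_natr polyC_eq0.
rewrite [X in _ *: X](_ : _ = \prod_(A in porbits (dual_perm l) | A != [set 0]%SET)
    ((1 + 'X) ^+ num1 A - (1 - 'X) ^+ num1 A)); last first.
  by apply: eq_bigr => A /andP[AP nA]; rewrite /pk (num1_eq0 AP) (negbTE nA).
(* Here R is {poly rat} and y is its indeterminate. *)
rewrite -(sum_single_cycle _ R2 hell) natrX -polyC_natr -polyC_exp mul_polyC.
by rewrite scalerA mulVf ?scale1r // expf_neq0.
Qed.
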